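(* Consider the two-dimensional Ripa model with conservative variables $\boldsymbol U=(h,hu,hv,h\theta)^T$ and equilibrium variables $\boldsymbol V=(h,u,v,p)^T$, $p=\frac12gh^2\theta$, with the spatial operator $$\mathrm{RHS}^{\mathrm{iso}}(\boldsymbol V,b,\boldsymbol\varphi)=\int_{\mathcal T}\boldsymbol F(\boldsymbol U(\boldsymbol V)):\nabla\boldsymbol\varphi\,d\boldsymbol x-\int_{\partial\mathcal T}\widehat{\boldsymbol F}^{\mathrm{mod}}\cdot\boldsymbol\varphi^{int_{\mathcal T}}\,ds+\int_{\mathcal T}\boldsymbol r(\boldsymbol U(\boldsymbol V),b)\cdot\boldsymbol\varphi\,d\boldsymbol x,$$ $$\widehat{\boldsymbol F}^{\mathrm{mod}}=\tfrac12\left(\boldsymbol F(\boldsymbol U^{int_{\mathcal T}})\cdot\boldsymbol n+\boldsymbol F(\boldsymbol U^{ext_{\mathcal T}})\cdot\boldsymbol n-\alpha\delta(\boldsymbol U^{ext_{\mathcal T}}-\boldsymbol U^{int_{\mathcal T}})\right),$$ $$\delta=\max\left(\frac{-\min(\boldsymbol u^{int_{\mathcal T}}\cdot\boldsymbol n,0)}{\max(|\boldsymbol u^{int_{\mathcal T}}\cdot\boldsymbol n|,1)},\ \frac{\max(\boldsymbol u^{ext_{\mathcal T}}\cdot\boldsymbol n,0)}{\max(|\boldsymbol u^{ext_{\mathcal T}}\cdot\boldsymbol n|,1)}\right),\qquad\boldsymbol u=(u,v),$$ and the third-order SSP Runge–Kutta time discretization with time step $\Delta t>0$: for all $\mathcal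 T\in\mathcal K$, $\boldsymbol\varphi\in\boldsymbol{\mathcal V}_h^k$, $$\int_{\mathcal T}\boldsymbol U(\boldsymbol V^{(1)})\cdot\boldsymbol\varphi\,d\boldsymbol x=\int_{\mathcal T}\boldsymbol U(\boldsymbol V^{n})\cdot\boldsymbol\varphi\,d\boldsymbol x+\Delta t\,\mathrm{RHS}^{\mathrm{iso}}(\boldsymbol V^n,b,\boldsymbol\varphi),$$ $$\int_{\mathcal T}\boldsymbol U(\boldsymbol V^{(2)})\cdot\boldsymbol\varphi\,d\boldsymbol x=\tfrac34\int_{\mathcal T}\boldsymbol U(\boldsymbol V^{n})\cdot\boldsymbol\varphi\,d\boldsymbol x+\tfrac14\left(\int_{\mathcal T}\boldsymbol U(\boldsymbol V^{(1)})\cdot\boldsymbol\varphi\,d\boldsymbol x+\Delta t\,\mathrm{RHS}^{\mathrm{iso}}(\boldsymbol V^{(1)},b,\boldsymbol\varphi)\right),$$ $$\int_{\mathcal T}\boldsymbol U(\boldsymbol V^{n+1})\cdot\boldsymbol\varphi\,d\boldsymbol x=\tfrac13\int_{\mathcal T}\boldsymbol U(\boldsymbol V^{n})\cdot\boldsymbol\varphi\,d\boldsymbol x+\tfrac23\left(\int_{\mathcal T}\boldsymbol U(\boldsymbol V^{(2)})\cdot\boldsymbol\varphi\,d\boldsymbol x+\Delta t\,\mathrm{RHS}^{\mathrm{iso}}(\boldsymbol V^{(2)},b,\boldsymbol\varphi)\right).$$ This fully-discrete method is exact for the isobaric equilibrium state $u=0$, $v=0$, $b=\text{constant}$, $h^2\theta=\text{constant}$.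 That is: if $b$ is constant and the initial state $\boldsymbol V^0=(h,u,v,p)^T\in\boldsymbol{\mathcal V}_h^k$ satisfies $u\equiv v\equiv0$ and $p\equiv c$ for a constant $c$ (with $h>0$), then the scheme is satisfied by $\boldsymbol V^n=\boldsymbol V^0$ for all $n\ge0$, with all inner stages $\boldsymbol V^{(1)}=\boldsymbol V^{(2)}=\boldsymbol V^0$.
   Context: **Ripa model.** $h_t+(hu)_x+(hv)_y=0$, $(hu)_t+(hu^2+\frac12gh^2\theta)_x+(huv)_y=-gh\theta b_x$, $(hv)_t+(huv)_x+(hv^2+\frac12gh^2\theta)_y=-gh\theta b_y$, $(h\theta)_t+(hu\theta)_x+(hv\theta)_y=0$, written as $\boldsymbol U_t+\nabla\cdot\boldsymbol F(\boldsymbol U)=\boldsymbol r(\boldsymbol U,b)$, with $h>0$ the water height, $(u,v)$ the velocity, $\theta>0$ the temperature, $g>0$ constant, $b=b(x,y)$ the bottom topography. The variable transformation is $\boldsymbol V(\boldsymbol U)=(h,\frac{hu}{h},\frac{hv}{h},\frac g2h\cdot h\theta)^T$ with inverse $\boldsymbol U(\boldsymbol V)=(h,h\cdot u,h\cdot v,\frac2g\frac ph)^T$. **Mesh and spaces.** $\mathcal K$ is a partition of $\Omega\subset\mathbb R^2$ into axis-parallel rectangular cells $\mathcal T$; $k\ge0$; $\mathcal W_h^k=\{w: w|_{\mathcal T}\in P^k(\mathcal T)\ \forall\mathcal T\in\mathcal K\}$, where $P^k(\mathcal T)$ is the space of polynomials of degree at most $k$; $\boldsymbol{\mathcal V}_h^k=(\mathcal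 W_h^k)^4$; all $\boldsymbol V^n,\boldsymbol V^{(1)},\boldsymbol V^{(2)}$ lie in $\boldsymbol{\mathcal V}_h^k$. $\boldsymbol n$ is the outward unit normal on $\partial\mathcal T$. For $\boldsymbol x\in\partial\mathcal T$, $w^{int_{\mathcal T}}(\boldsymbol x)=\lim_{\epsilon\to0^+}w(\boldsymbol x-\epsilon\boldsymbol n)$ and $w^{ext_{\mathcal T}}(\boldsymbol x)=\lim_{\epsilon\to0^+}w(\boldsymbol x+\epsilon\boldsymbol n)$; $\boldsymbol U^{int_{\mathcal T}}=\boldsymbol U(\boldsymbol V^{int_{\mathcal T}})$ and $\boldsymbol U^{ext_{\mathcal T}}=\boldsymbol U(\boldsymbol V^{ext_{\mathcal T}})$. ''$\cdot$'' is the Euclidean product and ''$:$'' the Frobenius product. $\alpha\ge0$ is the (finite) global maximum of the absolute values of the eigenvalues of $\frac{\partial\boldsymbol F}{\partial\boldsymbol U}\cdot\boldsymbol n$. All integrals are exact. The height $h$ is positive on each closed cell, and may be discontinuous across cells. At $\partial\Omega$ the exterior traces are taken from an isobaric equilibrium state with zero velocity and the same pressure $c$. *)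

(* Defs.v *)
From HB Require Import structures.
From mathcomp Require Import all_boot all_order all_algebra.
From mathcomp Require Import all_classical all_reals all_analysis.

Set Implicit Arguments.
Unset Strict Implicit.
Unset Printing Implicit Defensive.

Import Order.TTheory GRing.Theory Num.Theory numFieldNormedType.Exports.
Local Open Scope classical_set_scope.
Local Open Scope ring_scope.

(** * Ripa model *)

(** Conservative states are rows [(h, hu, hv, h theta)], equilibrium states are
    rows [(h, u, v, p)]. *)

Definition row4 (R : realType) (a0 a1 a2 a3 : R) : 'rV[R]_4 :=
  \row_(j < 4) nth 0 [:: a0; a1; a2; a3] j.

Definition flux (R : realType) (g : R) (U : 'rV[R]_4) : 'M[R]_(4, 2) :=
  let h := U 0 0 in
  let u := U 0 1 / h in
  let v := U 0 2 / h in
  let theta := U 0 3 / h in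
  let p := 2^-1 * g * h ^+ 2 * theta in
  let Fx := row4 (h * u) (h * u ^+ 2 + p) (h * u * v) (h * theta * u) in
  let Fy := row4 (h * v) (h * u * v) (h * v ^+ 2 + p) (h * theta * v) in
  \matrix_(i < 4, j < 2) (if j == 0 then Fx 0 i else Fy 0 i).

Definition flux_dot (R : realType) (g : R) (n : R * R) (U : 'rV[R]_4) :
    'rV[R]_4 :=
  \row_(i < 4) (flux g U i 0 * n.1 + flux g U i 1 * n.2).

Definition dx (R : realType) (f : R * R -> R) (x : R * R) : R :=
  derive1 (fun s => f (s, x.2)) x.1.

Definition dy (R : realType) (f : R * R -> R) (x : R * R) : R :=
  derive1 (fun s => f (x.1, s)) x.2.

Definition source (R : realType) (g : R) (b : R * R -> R) (U : 'rV[R]_4)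
    (x : R * R) : 'rV[R]_4 :=
  let h := U 0 0 in
  let theta := U 0 3 / h in
  row4 0 (- (g * h * theta * dx b x)) (- (g * h * theta * dy b x)) 0.

Definition cons_of_equil (R : realType) (g : R) (V : 'rV[R]_4) : 'rV[R]_4 :=
  let h := V 0 0 in
  row4 h (h * V 0 1) (h * V 0 2) (2 / g * (V 0 3 / h)).

(** * Mesh *)

Record rect (R : realType) := Rect {
  xlo : R; xhi : R; ylo : R; yhi : R;
  xlo_lt_xhi : xlo < xhi;
  ylo_lt_yhi : ylo < yhi }.

(** Cells are open rectangles, so that functions which are polynomial on each
    cell are left unconstrained on the mesh skeleton, where they jump. *)
Definition cell (R : realType) (T : rect R) : set (R * R) :=
  `]xlo T, xhi T[ `*` `]ylo T, yhi T[.

Definition closed_cell (R : realType) (T : rect R) : set (R * R) :=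
  `[xlo T, xhi T] `*` `[ylo T, yhi T].

(** Hanging nodes are allowed. *)
Definition mesh_of (R : realType) (Omega : set (R * R)) (I : finType)
    (K : I -> rect R) : Prop :=
  [/\ open Omega,
      forall i, cell (K i) `<=` Omega,
      forall i j, i != j -> cell (K i) `&` cell (K j) = set0
    & Omega `<=` \bigcup_i closed_cell (K i)].

Definition normals (R : realType) : set (R * R) :=
  [set n | [\/ n = (1, 0), n = (- 1, 0), n = (0, 1) | n = (0, - 1)]].

Definition int_cell (R : realType) (T : rect R) (f : R * R -> R) : R :=
  \int[(@lebesgue_measure R \x @lebesgue_measure R)%E]_(x in cell T) f x.

(** [f x n] is the integrand at the boundary point [x] with outward unit normal
    [n]; the four corners, where there is no normal, are left out. *)
Definition int_boundary (R : realType) (T : rect R)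
    (f : R * R -> R * R -> R) : R :=
    \int[@lebesgue_measure R]_(y in `]ylo T, yhi T[) f (xhi T, y) (1, 0)
  + \int[@lebesgue_measure R]_(y in `]ylo T, yhi T[) f (xlo T, y) (- 1, 0)
  + \int[@lebesgue_measure R]_(x in `]xlo T, xhi T[) f (x, yhi T) (0, 1)
  + \int[@lebesgue_measure R]_(x in `]xlo T, xhi T[) f (x, ylo T) (0, - 1).

(** * Discontinuous Galerkin space *)

(** Polynomial function of total degree at most [k]. *)
Definition poly2 (R : realType) (k : nat) (q : R * R -> R) : Prop :=
  exists a : nat -> nat -> R, forall x,
    q x = \sum_(i < k.+1) \sum_(j < k.+1 | (i + j <= k)%N)
            a i j * x.1 ^+ i * x.2 ^+ j.

Definition in_Wh (R : realType) (I : finType) (K : I -> rect R) (k : nat)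
    (w : R * R -> R) : Prop :=
  forall i, exists2 q, poly2 k q & forall x, cell (K i) x -> w x = q x.

Definition component (R : realType) (j : 'I_4) (V : R * R -> 'rV[R]_4) :
  R * R -> R := fun x => V x 0 j.

Definition in_Vh (R : realType) (I : finType) (K : I -> rect R) (k : nat)
    (V : R * R -> 'rV[R]_4) : Prop :=
  forall j, in_Wh K k (component j V).

(** On each cell the values up to the boundary are those of the polynomial that
    represents [w] inside. *)
Definition pos_on_closed_cells (R : realType) (I : finType) (K : I -> rect R)
    (k : nat) (w : R * R -> R) : Prop :=
  forall i, exists q,
    [/\ poly2 k q, forall x, cell (K i) x -> w x = q x
      & forall x, closed_cell (K i) x -> 0 < q x].

(** * Traces *)

Definition trace_int (R : realType) (w : R * R -> R) (x n : R * R) : R :=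
  lim (w (x.1 - e * n.1, x.2 - e * n.2) @[e --> 0^'+]).

Definition trace_ext (R : realType) (w : R * R -> R) (x n : R * R) : R :=
  lim (w (x.1 + e * n.1, x.2 + e * n.2) @[e --> 0^'+]).

Definition V_int (R : realType) (V : R * R -> 'rV[R]_4) (x n : R * R) :
    'rV[R]_4 :=
  \row_(j < 4) trace_int (component j V) x n.

(** [Vbd] is the boundary datum. *)
Definition V_ext (R : realType) (Omega : set (R * R))
    (Vbd V : R * R -> 'rV[R]_4) (x n : R * R) : 'rV[R]_4 :=
  if `[< (closure Omega `\` Omega) x >] then Vbd x
  else \row_(j < 4) trace_ext (component j V) x n.

(** * Numerical flux and spatial operator *)

(** For positive depth and temperature the system is hyperbolic, so that real
    eigenvalues are all of them.  The supremum over the open cells is the maximum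
    over the closed cells of the continuous one-sided extensions.  ['J] acts on
    row vectors, i.e. it is the transpose of the usual Jacobian matrix. *)
Definition max_speed (R : realType) (g : R) (I : finType) (K : I -> rect R)
    (V : R * R -> 'rV[R]_4) : R :=
  sup [set s : R | exists i x n lambda,
    [/\ cell (K i) x, normals n,
        eigenvalue ('J (flux_dot g n) (cons_of_equil g (V x))) lambda
      & s = `|lambda|]].

Definition vel_dot (R : realType) (V : 'rV[R]_4) (n : R * R) : R :=
  V 0 1 * n.1 + V 0 2 * n.2.

Definition delta (R : realType) (Vi Ve : 'rV[R]_4) (n : R * R) : R :=
  let ui := vel_dot Vi n in
  let ue := vel_dot Ve n in
  Num.max (- Num.min ui 0 / Num.max `|ui| 1) (Num.max ue 0 / Num.max `|ue| 1).

Definition flux_mod (R : realType) (g alpha : R) (Vi Ve : 'rV[R]_4)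
    (n : R * R) : 'rV[R]_4 :=
  let Ui := cons_of_equil g Vi in
  let Ue := cons_of_equil g Ve in
  2^-1 *: (flux_dot g n Ui + flux_dot g n Ue
           - (alpha * delta Vi Ve n) *: (Ue - Ui)).

Definition dot4 (R : realType) (a b : 'rV[R]_4) : R :=
  \sum_(j < 4) a 0 j * b 0 j.

Definition frob (R : realType) (A B : 'M[R]_(4, 2)) : R :=
  \sum_(i < 4) \sum_(j < 2) A i j * B i j.

Definition grad (R : realType) (phi : R * R -> 'rV[R]_4) (x : R * R) :
    'M[R]_(4, 2) :=
  \matrix_(i < 4, j < 2)
    (if j == 0 then dx (component i phi) x else dy (component i phi) x).

Definition RHS_iso (R : realType) (g : R) (Omega : set (R * R)) (I : finType)
    (K : I -> rect R) (Vbd : R * R -> 'rV[R]_4) (T : rect R)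
    (V : R * R -> 'rV[R]_4) (b : R * R -> R) (phi : R * R -> 'rV[R]_4) : R :=
    int_cell T (fun x => frob (flux g (cons_of_equil g (V x))) (grad phi x))
  - int_boundary T (fun x n =>
      dot4 (flux_mod g (max_speed g K V) (V_int V x n)
              (V_ext Omega Vbd V x n) n)
           (V_int phi x n))
  + int_cell T (fun x => dot4 (source g b (cons_of_equil g (V x)) x) (phi x)).

(** * Time discretization *)

Definition mass (R : realType) (g : R) (T : rect R)
    (V phi : R * R -> 'rV[R]_4) : R :=
  int_cell T (fun x => dot4 (cons_of_equil g (V x)) (phi x)).

Definition admissible (R : realType) (I : finType) (K : I -> rect R) (k : nat)
    (V : R * R -> 'rV[R]_4) : Prop :=
  in_Vh K k V /\ pos_on_closed_cells K k (component 0 V).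

(** One step from [V] to [Vnew] with inner stages [V1] and [V2]. *)
Definition ssprk3_step (R : realType) (g dt : R) (Omega : set (R * R))
    (I : finType) (K : I -> rect R) (k : nat) (Vbd : R * R -> 'rV[R]_4)
    (b : R * R -> R) (V V1 V2 Vnew : R * R -> 'rV[R]_4) : Prop :=
  forall i phi, in_Vh K k phi ->
    let T := K i in
    let RHS W := RHS_iso g Omega K Vbd T W b phi in
    [/\ mass g T V1 phi = mass g T V phi + dt * RHS V,
        mass g T V2 phi
          = 3 / 4 * mass g T V phi + 1 / 4 * (mass g T V1 phi + dt * RHS V1)
      & mass g T Vnew phi
          = 1 / 3 * mass g T V phi + 2 / 3 * (mass g T V2 phi + dt * RHS V2)].

Definition scheme_solution (R : realType) (g dt : R) (Omega : set (R * R))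
    (I : finType) (K : I -> rect R) (k : nat) (Vbd : R * R -> 'rV[R]_4)
    (b : R * R -> R) (V V1 V2 : nat -> R * R -> 'rV[R]_4) : Prop :=
  forall n,
    [/\ admissible K k (V n), admissible K k (V1 n), admissible K k (V2 n)
      & ssprk3_step g dt Omega K k Vbd b (V n) (V1 n) (V2 n) (V n.+1)].

Definition isobaric_at (R : realType) (c : R) (W : 'rV[R]_4) : Prop :=
  [/\ W 0 1 = 0, W 0 2 = 0 & W 0 3 = c].

(* Main.v *)
Require Import Defs.
From HB Require Import structures.
From mathcomp Require Import all_boot all_order all_algebra.
From mathcomp Require Import polyXY ring lra.
From mathcomp Require Import all_classical all_reals all_analysis.
From mathcomp Require Import measurable_realfun.

Set Implicit Arguments.
Unset Strict Implicit.
Unset Printing Implicit Defensive.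

Import Order.TTheory GRing.Theory Num.Theory numFieldNormedType.Exports.
Local Open Scope classical_set_scope.
Local Open Scope ring_scope.

(** At an isobaric state at rest the flux is F_x = (0, c, 0, 0) and
    F_y = (0, 0, c, 0) in every cell, although the height jumps: the velocities
    vanish, so that [delta] switches the numerical dissipation off and the
    numerical flux is the exact flux (0, c n_1, c n_2, 0).  Since the source
    vanishes, the spatial operator is c times the defect in the divergence
    theorem for a polynomial field on a rectangle, which is zero.  At a hanging
    node the normal may run along an edge of the mesh, where the state is
    unconstrained and the exterior trace is a junk value; there are finitely many
    such points, so the boundary integrals do not see them. *)

(** * Polynomials in two variables *)

Lemma poly2_horner2 (R : realType) k (q : R * R -> R) :
  poly2 k q -> exists u : {poly {poly R}}, forall x, q x = u.[x.1, x.2].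
Proof.
move=> [a qE].
exists (\sum_(i < k.+1) \sum_(j < k.+1 | (i + j <= k)%N)
          (a i j *: 'X^j) *: 'X^i) => x.
rewrite qE !horner_sum; apply: eq_bigr => i _.
rewrite !horner_sum; apply: eq_bigr => j _.
rewrite hornerZ hornerXn -polyC_exp hornerM hornerC hornerZ hornerXn.
by rewrite mulrAC.
Qed.

Lemma continuous_horner2 (R : realType) (u : {poly {poly R}}) :
  continuous (fun x : R * R => u.[x.1, x.2]).
Proof.
elim/poly_ind: u => [|u c IH] x.
  under eq_fun do rewrite !horner0.
  exact: cst_continuous.
under eq_fun do rewrite hornerMXaddC hornerD hornerM hornerC.
apply: cvgD; first by apply: cvgM; [exact: IH|exact: cvg_fst].
by apply: (continuous_comp cvg_snd); exact: continuous_horner.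
Qed.

Lemma measurable_horner (R : realType) (p : {poly R}) (D : set R) :
  measurable_fun D (horner p).
Proof.
apply/measurable_funTS; apply: continuous_measurable_fun.
exact: continuous_horner.
Qed.

(** The sigma-algebra here is the product one, so the proof goes by induction on [u], through sums
    and products of measurable functions. *)
Lemma measurable_horner2 (R : realType) (u : {poly {poly R}}) D :
  measurable_fun D (fun x : measurableTypeR R * measurableTypeR R =>
    u.[x.1, x.2] : R).
Proof.
apply: measurable_funTS; elim/poly_ind: u => [|u c IH].
  by under eq_fun do rewrite !horner0; exact: measurable_cst.
under eq_fun do rewrite hornerMXaddC hornerD hornerM hornerC.
apply: measurable_funD; first by apply: measurable_realfun.measurable_funM.
by apply: measurableT_comp => //; exact: measurable_horner.
Qed.

Lemma dy_horner2 (R : realType) (u : {poly {poly R}}) (x : R * R) :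
  dy (fun x => u.[x.1, x.2]) x = (u.[x.1%:P])^`().[x.2].
Proof. by rewrite /dy /= derivE. Qed.

(** Exhibits the slice at fixed [y] as a univariate polynomial in [x], which can then be
    differentiated and integrated. *)
Lemma horner2_swap_horner (R : realType) (u : {poly {poly R}}) (x y : R) :
  u.[x, y] = ((swapXY u).[y%:P]).[x].
Proof. by rewrite horner2_swapXY. Qed.

Lemma dx_horner2 (R : realType) (u : {poly {poly R}}) (x : R * R) :
  dx (fun x => u.[x.1, x.2]) x = ((swapXY u).[x.2%:P])^`().[x.1].
Proof.
rewrite /dx /=.
under eq_fun do rewrite horner2_swap_horner.
by rewrite derivE.
Qed.

(** The outer variable of [u], in which [u^`()] is taken, is the first one:
    [u.[x, y]] is [u.[x%:P].[y]]. *)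
Lemma deriv_horner2 (R : realType) (u : {poly {poly R}}) (x y : R) :
  ((swapXY u).[y%:P])^`().[x] = u^`().[x, y].
Proof.
rewrite horner_swapXY deriv_map -horner_swapXY.
exact: horner2_swapXY.
Qed.

(** * The divergence theorem on a rectangle *)

Lemma integral_deriv (R : realType) (p : {poly R}) (a b : R) : a < b ->
  (\int[@lebesgue_measure R]_(x in `]a, b[) (p^`().[x])%:E
   = (p.[b] - p.[a])%:E)%E.
Proof.
move=> ab.
have cp (q : {poly R}) : {within `[a, b], continuous (horner q)}.
  by apply: continuous_subspaceT; exact: continuous_horner.
(* The endpoints are null, so the integral may be taken over the closed interval, where the
   fundamental theorem of calculus applies. *)
rewrite -(@integral_itv_bndoo _ a b _ true false); last first.
  by apply/measurable_EFinP; exact: measurable_horner.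
rewrite (continuous_FTC2 ab (cp _) (F := horner p))//.
- split.
  + by move=> x _; exact: derivable_horner.
  + by apply: cvg_at_right_filter; exact: continuous_horner.
  + by apply: cvg_at_left_filter; exact: continuous_horner.
- by move=> x _; rewrite derivE.
Qed.

Lemma cell_sub_closed_cell (R : realType) (T : rect R) :
  cell T `<=` closed_cell T.
Proof. by move=> x [/= x1 x2]; split; exact: subset_itv_oo_cc. Qed.

Lemma measurable_cell (R : realType) (T : rect R) :
  measurable (cell T : set (measurableTypeR R * measurableTypeR R)).
Proof. by apply: measurableX; exact: measurable_itv. Qed.

(** The cell has finite measure, and the polynomial is bounded on it because the closed cell is
    compact. *)
Lemma integrable_horner2 (R : realType) (T : rect R) (u : {poly {poly R}}) :
  (@lebesgue_measure R \x @lebesgue_measure R)%E.-integrable (cell T)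
    (EFin \o (fun x => u.[x.1, x.2])).
Proof.
apply: measurable_bounded_integrable.
- exact: measurable_cell.
- rewrite [ltLHS](_ : _ = (@lebesgue_measure R `]xlo T, xhi T[
      * @lebesgue_measure R `]ylo T, yhi T[)%E); last exact: product_measure1E.
  rewrite !lebesgue_measure_itv/= !lte_fin.
  by rewrite xlo_lt_xhi ylo_lt_yhi -!EFinB -EFinM ltry.
- exact: measurable_horner2.
- have /compact_bounded[M [_ Mu]] : compact
      ((fun x : R * R => u.[x.1, x.2]) @` closed_cell T).
    apply: continuous_compact.
      by apply: continuous_subspaceT; exact: continuous_horner2.
    by apply: compact_setX; exact: segment_compact.
  exists M; split; first by rewrite num_real.
  move=> N MN x Tx; apply: Mu => //=.
  by exists x => //; exact: cell_sub_closed_cell.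
Qed.

(** Fubini, with the second variable integrated first; the inner integrals are assumed finite, so
    the outer one can be read as a real integral. *)
Lemma int_cell_iter12 (R : realType) (T : rect R)
    (f : R * R -> R) (h : R -> R) :
  (@lebesgue_measure R \x @lebesgue_measure R)%E.-integrable (cell T)
    (EFin \o f) ->
  (forall x, (\int[@lebesgue_measure R]_(y in `]ylo T, yhi T[) (f (x, y))%:E
     = (h x)%:E)%E) ->
  int_cell T f = (\int[@lebesgue_measure R]_(x in `]xlo T, xhi T[) h x)%R.
Proof.
move=> intf fh; rewrite /int_cell /Rintegral; congr fine.
rewrite integral_mkcond -integral12_prod_meas1; last first.
  by rewrite -integrable_mkcond//; exact: measurable_cell.
rewrite [RHS]integral_mkcond; apply: eq_integral => x _.
rewrite /fubini_F patchE; case: ifPn => [|/negP] xT.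
  rewrite -fh [RHS]integral_mkcond; apply: eq_integral => y _.
  rewrite !patchE; congr (if _ then _ else _).
  apply/idP/idP; rewrite !inE; first by case.
  by move=> ?; split=> //; exact/set_mem.
(* For [x] outside the horizontal range, the slice of the cell is empty. *)
rewrite integral0_eq// => y _; rewrite patchE ifF//.
by apply/negP; rewrite inE => -[/mem_set].
Qed.

Lemma int_cell_iter21 (R : realType) (T : rect R)
    (f : R * R -> R) (h : R -> R) :
  (@lebesgue_measure R \x @lebesgue_measure R)%E.-integrable (cell T)
    (EFin \o f) ->
  (forall y, (\int[@lebesgue_measure R]_(x in `]xlo T, xhi T[) (f (x, y))%:E
     = (h y)%:E)%E) ->
  int_cell T f = (\int[@lebesgue_measure R]_(y in `]ylo T, yhi T[) h y)%R.
Proof.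
move=> intf fh; rewrite /int_cell /Rintegral; congr fine.
rewrite integral_mkcond -integral21_prod_meas1; last first.
  by rewrite -integrable_mkcond//; exact: measurable_cell.
rewrite [RHS]integral_mkcond; apply: eq_integral => y _.
rewrite /fubini_G patchE; case: ifPn => [|/negP] yT.
  rewrite -fh [RHS]integral_mkcond; apply: eq_integral => x _.
  rewrite !patchE; congr (if _ then _ else _).
  apply/idP/idP; rewrite !inE; first by case.
  by move=> ?; split=> //; exact/set_mem.
rewrite integral0_eq// => x _; rewrite patchE ifF//.
by apply/negP; rewrite inE => -[_ /mem_set].
Qed.

Lemma integrable_horner (R : realType) (p : {poly R}) (a b : R) :
  (@lebesgue_measure R).-integrable `]a, b[ (EFin \o horner p).
Proof.
have cp : (@lebesgue_measure R).-integrable `[a, b] (EFin \o horner p).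
  apply: continuous_compact_integrable; first exact: segment_compact.
  by apply: continuous_subspaceT; exact: continuous_horner.
apply: integrableS cp => //; exact: subset_itv_oo_cc.
Qed.

Lemma integrable_horner2_l (R : realType) (u : {poly {poly R}}) (y a b : R) :
  (@lebesgue_measure R).-integrable `]a, b[ (EFin \o (fun x => u.[x, y])).
Proof.
rewrite (funext (fun x => horner2_swap_horner u x y)).
exact: integrable_horner.
Qed.

Lemma integrable_dx (R : realType) (T : rect R) (u : {poly {poly R}}) :
  (@lebesgue_measure R \x @lebesgue_measure R)%E.-integrable (cell T)
    (EFin \o dx (fun x => u.[x.1, x.2])).
Proof.
apply: eq_integrable (integrable_horner2 T u^`()); first exact: measurable_cell.
by move=> x _; rewrite /= dx_horner2 deriv_horner2.
Qed.

(** Swapping, differentiating in the outer variable and swapping back shows that the second partial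
    derivative is again a polynomial. *)
Lemma integrable_dy (R : realType) (T : rect R) (u : {poly {poly R}}) :
  (@lebesgue_measure R \x @lebesgue_measure R)%E.-integrable (cell T)
    (EFin \o dy (fun x => u.[x.1, x.2])).
Proof.
apply: eq_integrable (integrable_horner2 T (swapXY (swapXY u)^`())).
  exact: measurable_cell.
move=> x _; rewrite /= dy_horner2 -{2}[u]swapXYK.
by rewrite deriv_horner2 horner2_swapXY.
Qed.

(** Integrating in [x] first leaves, by the fundamental theorem of calculus, the values on the two
    vertical sides. *)
Lemma int_cell_dx (R : realType) (T : rect R) (u : {poly {poly R}}) :
  int_cell T (dx (fun x => u.[x.1, x.2]))
  = (\int[@lebesgue_measure R]_(y in `]ylo T, yhi T[) u.[xhi T, y]
     - \int[@lebesgue_measure R]_(y in `]ylo T, yhi T[) u.[xlo T, y])%R.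
Proof.
rewrite -RintegralB//; [|exact: integrable_horner|exact: integrable_horner].
apply: int_cell_iter21; first exact: integrable_dx.
move=> y; under eq_integral => x _ do rewrite dx_horner2/=.
by rewrite integral_deriv ?xlo_lt_xhi// -!horner2_swap_horner.
Qed.

Lemma int_cell_dy (R : realType) (T : rect R) (u : {poly {poly R}}) :
  int_cell T (dy (fun x => u.[x.1, x.2]))
  = (\int[@lebesgue_measure R]_(x in `]xlo T, xhi T[) u.[x, yhi T]
     - \int[@lebesgue_measure R]_(x in `]xlo T, xhi T[) u.[x, ylo T])%R.
Proof.
rewrite -RintegralB//;
  [|exact: integrable_horner2_l|exact: integrable_horner2_l].
apply: int_cell_iter12; first exact: integrable_dy.
move=> x; under eq_integral => y _ do rewrite dy_horner2/=.
by rewrite integral_deriv// ylo_lt_yhi.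
Qed.

(** * Changing an integrand at finitely many points *)

Lemma integral_setD_seq (R : realType) (s : seq R) (D : set R)
    (f : R -> \bar R) :
  measurable (D : set (measurableTypeR R)) ->
  measurable_fun (D `\` [set` s] : set (measurableTypeR R)) f ->
  (\int[@lebesgue_measure R]_(x in D `\` [set` s]) f x
   = \int[@lebesgue_measure R]_(x in D) f x)%E.
Proof.
move=> mD; elim: s => [|r s IH] mf; first by rewrite set_nil setD0.
have ms : measurable ([set` s] : set (measurableTypeR R)).
  by apply: countable_measurable => //; exact/finite_set_countable/finite_seq.
have E : D `\` [set` r :: s] = (D `\` [set` s]) `\ r.
  rewrite setDDl setUC; congr (_ `\` _); apply/seteqP; split=> x /=.
    by rewrite in_cons => /predU1P[]; [left|right].
  by rewrite in_cons => -[->|->]; rewrite ?eqxx ?orbT.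
rewrite E in mf *.
have mDs : measurable (D `\` [set` s] : set (measurableTypeR R)).
  exact: measurableD.
rewrite integral_setD1//; last exact: measurableD.
(* Measurability extends across the point [r], since any function is measurable on a singleton. *)
apply: IH; have [rD|rD] := pselect ((D `\` [set` s]) r).
  rewrite -(setD1K rD); apply/measurable_funU => //; first exact: measurableD.
  by split => //; exact: measurable_fun_set1.
by rewrite not_setD1 in mf.
Qed.

(** Measurability is asked of [g] alone: [f] will be the boundary integrand, whose values at the
    points of [s] are uncontrolled, and off [s] it inherits measurability from [g]. *)
Lemma eq_Rintegral_setD_seq (R : realType) (s : seq R) (D : set R)
    (f g : R -> R) :
  measurable (D : set (measurableTypeR R)) ->
  measurable_fun (D : set (measurableTypeR R)) g ->
  (forall x, D x -> x \notin s -> f x = g x) ->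
  (\int[@lebesgue_measure R]_(x in D) f x
   = \int[@lebesgue_measure R]_(x in D) g x)%R.
Proof.
move=> mD mg fg; rewrite /Rintegral; congr fine.
have ms : measurable ([set` s] : set (measurableTypeR R)).
  by apply: countable_measurable => //; exact/finite_set_countable/finite_seq.
have E : {in D `\` [set` s], (EFin \o f) =1 (EFin \o g)}.
  move=> x; rewrite inE => -[Dx /negP xs] /=; congr EFin; exact: fg.
have mgs : measurable_fun (D `\` [set` s] : set (measurableTypeR R))
    (EFin \o g).
  by apply/measurable_EFinP; apply: measurable_funS mg.
rewrite -(integral_setD_seq (s := s))//; last first.
  by apply: eq_measurable_fun mgs => x /E /= ->.
by rewrite -[RHS](integral_setD_seq (s := s))//; exact: eq_integral.
Qed.

(** * Traces as limits along rays *)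

Definition ray (R : realType) (x n : R * R) (e : R) : R * R :=
  (x.1 + e * n.1, x.2 + e * n.2).

Lemma ray_cvg (R : realType) (x n : R * R) : ray x n e @[e --> 0^'+] --> x.
Proof.
apply: cvg_at_right_filter; rewrite [x in _ --> x]surjective_pairing.
have lin (a m : R) : a + e * m @[e --> 0] --> a.
  have : a + e * m @[e --> (0 : R)] --> a + 0 * m.
    by apply: cvgD; [exact: cvg_cst|apply: cvgMl; exact: cvg_id].
  by rewrite mul0r addr0.
exact: (cvg_pair (lin x.1 n.1) (lin x.2 n.2)).
Qed.

Lemma trace_ext_eq (R : realType) (w q : R * R -> R) (x n : R * R) :
  (\forall e \near 0^'+, w (ray x n e) = q (ray x n e)) ->
  {for x, continuous q} -> trace_ext w x n = q x.
Proof.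
move=> wq cq; apply: cvg_lim => //.
have : q (ray x n e) @[e --> 0^'+] --> q x.
  by apply: cvg_comp; [exact: ray_cvg|exact: cq].
by apply: cvg_trans; apply: near_eq_cvg; apply: filterS wq => e.
Qed.

(** Reversing the normal lets the same facts about rays serve both kinds of trace. *)
Lemma trace_intE (R : realType) (w : R * R -> R) (x n : R * R) :
  trace_int w x n = trace_ext w x (- n.1, - n.2).
Proof.
by rewrite /trace_int /trace_ext /=; under eq_fun do rewrite -!mulrN.
Qed.

Lemma V_intE (R : realType) (V : R * R -> 'rV[R]_4) (x n : R * R) :
  V_int V x n = \row_(j < 4) trace_ext (component j V) x (- n.1, - n.2).
Proof. by apply/rowP => j; rewrite !mxE trace_intE. Qed.

Lemma closed_closed_cell (R : realType) (T : rect R) : closed (closed_cell T).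
Proof.
apply: compact_closed; first exact: norm_hausdorff.
by apply: compact_setX; exact: segment_compact.
Qed.

Lemma convex_cell_ray (R : realType) (T : rect R) (x n : R * R) (e1 e e2 : R) :
  e1 <= e <= e2 -> cell T (ray x n e1) -> cell T (ray x n e2) ->
  cell T (ray x n e).
Proof.
have itv (a m lo hi : R) : e1 <= e <= e2 ->
    a + e1 * m \in `]lo, hi[ -> a + e2 * m \in `]lo, hi[ ->
    a + e * m \in `]lo, hi[.
  rewrite !in_itv /= => /andP[e1e ee2] /andP[l1 h1] /andP[l2 h2].
  (* Each coordinate is monotone in [e], in the direction given by the sign of [m], hence lies
     between its values at [e1] and [e2]. *)
  by have [m0|m0] := leP 0 m; apply/andP; split; nra.
by move=> e12 [/= x1 y1] [/= x2 y2]; split; exact: itv e12 _ _.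
Qed.

(** A cell meets a ray in an interval, so that, among finitely many cells, a ray
    that stays in their union near its origin stays in one of them. *)
Lemma near_ray_one_cell (R : realType) (I : finType) (K : I -> rect R)
    (x n : R * R) :
  (\forall e \near 0^'+, exists i, cell (K i) (ray x n e)) ->
  exists i, \forall e \near 0^'+, cell (K i) (ray x n e).
Proof.
move=> Kx; apply: contrapT => /forallNP noi.
have : \forall e \near (0 : R)^'+, forall i, ~ cell (K i) (ray x n e).
  apply: filter_forall => i.
  have [[e0 e0_gt0 Ke0]|nKi] :=
    pselect (exists2 e0, 0 < e0 & cell (K i) (ray x n e0)); last first.
    near=> e => Kie; apply: nKi; exists e => //; near: e; exact: nbhs_right_gt.
  have [[e1 e1_gt0 nK1]|Ki] :=
    pselect (exists2 e1, 0 < e1 < e0 & ~ cell (K i) (ray x n e1)); last first.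
    exfalso; apply: (noi i); near=> e; apply: contrapT => nKe; apply: Ki.
    exists e => //; apply/andP; split; near: e; first exact: nbhs_right_gt.
    exact: nbhs_right_lt.
  move: e1_gt0 => /andP[e1_gt0 e10].
  (* If the ray were in the cell at some [e] below [e1], then convexity together with [e0] would put
     [e1] in it too. *)
  near=> e => Ke; apply: nK1; apply: convex_cell_ray Ke Ke0.
  by rewrite (ltW e10) andbT; near: e; exact: nbhs_right_ltW.
move=> nK; near (0 : R)^'+ => e.
have [i] : exists i, cell (K i) (ray x n e) by near: e.
by apply: (near nK e).
Unshelve. all: by end_near. Qed.

(** An affine function of [e] that is not constantly [r] equals [r] at most once, namely at
    [(r - a) / m]; small positive [e] avoid that parameter. *)
Lemma near_ray_neq (R : realType) (a m r : R) : (m != 0) || (a != r) ->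
  \forall e \near 0^'+, a + e * m != r.
Proof.
have [->/=|m0 _] := eqVneq m 0.
  by move=> ar; near=> e; rewrite mulr0 addr0.
have [->|ar] := eqVneq a r.
  near=> e; have e0 : e != 0 by near: e; exact: nbhs_right_neq.
  by rewrite -subr_eq0 addrAC subrr add0r mulf_neq0.
near=> e; have e0 : 0 < e by near: e; exact: nbhs_right_gt.
have : e < `|(r - a) / m|.
  by near: e; apply: nbhs_right_lt;
    rewrite normr_gt0 mulf_neq0 ?invr_neq0// subr_eq0 eq_sym.
apply: contraTneq => E; rewrite -leNgt.
have -> : r - a = e * m by lra.
by rewrite mulfK// gtr0_norm.
Unshelve. all: by end_near. Qed.

(** The hypotheses prevent the ray from running along one of the four lines bounding [T], so it is
    off all of them for small positive [e]. This upgrades the covering of [Omega] by closed cells to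
    open ones. *)
Lemma near_ray_cell (R : realType) (T : rect R) (x n : R * R) :
  (n.1 != 0) || (x.1 \notin [:: xlo T; xhi T]) ->
  (n.2 != 0) || (x.2 \notin [:: ylo T; yhi T]) ->
  \forall e \near 0^'+, closed_cell T (ray x n e) -> cell T (ray x n e).
Proof.
rewrite !inE !negb_or !orb_andr => /andP[xl xh] /andP[yl yh].
near=> e => -[/=]; rewrite !in_itv /= => /andP[x1 x2] /andP[y1 y2].
split => /=; rewrite in_itv /= !lt_neqAle ?x1 ?x2 ?y1 ?y2 !andbT;
  apply/andP; split.
- by rewrite eq_sym; near: e; exact: near_ray_neq.
- by near: e; exact: near_ray_neq.
- by rewrite eq_sym; near: e; exact: near_ray_neq.
- by near: e; exact: near_ray_neq.
Unshelve. all: by end_near. Qed.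

(** Velocity and pressure are constant along the ray. A limit of positive heights could vanish, but
    this one is the value of the representing polynomial at [x], which lies in the closed cell. *)
Lemma trace_isobaric (R : realType) (c : R) (I : finType) (K : I -> rect R)
    (k : nat) (V : R * R -> 'rV[R]_4) (i : I) (x n : R * R) :
  pos_on_closed_cells K k (component 0 V) ->
  (forall y, cell (K i) y -> isobaric_at c (V y)) ->
  (\forall e \near 0^'+, cell (K i) (ray x n e)) ->
  let W := \row_(j < 4) trace_ext (component j V) x n in
  0 < W 0 0 /\ isobaric_at c W.
Proof.
move=> posV isoV nKx W.
have cst_trace (j : 'I_4) (a : R) :
    (forall y, cell (K i) y -> V y 0 j = a) -> W 0 j = a.
  move=> Va; rewrite mxE (@trace_ext_eq _ _ (cst a))//;
    last exact: cst_continuous.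
  by apply: filterS nKx => e; exact: Va.
split; last first.
  by split; apply: cst_trace => y /isoV[].
have [q [/poly2_horner2[u qu] Vq q_gt0]] := posV i.
rewrite mxE (@trace_ext_eq _ _ q).
- have nTx : \forall e \near 0^'+, closed_cell (K i) (ray x n e).
    by apply: filterS nKx => e; exact: cell_sub_closed_cell.
  apply: q_gt0; exact: (@closed_cvg _ _ _ _ (ray x n) (closed_cell (K i))
    (@closed_closed_cell _ (K i)) nTx x (@ray_cvg _ x n)).
- by apply: filterS nKx => e; exact: Vq.
- by rewrite (funext qu); exact: continuous_horner2.
Qed.

(** * The flux at an isobaric state at rest *)

Lemma dot4E (R : realType) (a b : 'rV[R]_4) :
  dot4 a b = a 0 0 * b 0 0 + a 0 1 * b 0 1 + a 0 2 * b 0 2 + a 0 3 * b 0 3.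
Proof.
rewrite /dot4 !big_ord_recl big_ord0 addr0 !addrA.
by repeat congr (_ + _); congr (_ * _); congr fun_of_matrix; apply: val_inj.
Qed.

Lemma frobE (R : realType) (A B : 'M[R]_(4, 2)) :
  frob A B =
  dot4 (\row_i A i 0) (\row_i B i 0) + dot4 (\row_i A i 1) (\row_i B i 1).
Proof.
rewrite /frob /dot4 -big_split; apply: eq_bigr => i _.
rewrite !big_ord_recl big_ord0 addr0 !mxE.
by congr (_ + _ * _); congr fun_of_matrix; apply: val_inj.
Qed.

Lemma flux_isobaric (R : realType) (g c : R) (W : 'rV[R]_4) :
  0 < g -> 0 < W 0 0 -> isobaric_at c W ->
  flux g (cons_of_equil g W) =
  \matrix_(i < 4, j < 2)
    (if j == 0 then row4 0 c 0 0 0 i else row4 0 0 c 0 0 i).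
Proof.
move=> g0 h0 [u0 v0 pc]; apply/matrixP => i j.
rewrite /flux /cons_of_equil !mxE /=.
rewrite u0 v0 pc !(mulr0, mul0r) expr0n /= !(mulr0, mul0r, add0r).
(* Going from pressure to [h theta] and back cancels the height, so its jumps do not reach the
   flux. *)
have -> : 2^-1 * g * W 0 0 ^+ 2 * (2 / g * (c / W 0 0) / W 0 0) = c.
  by field; rewrite ?gt_eqF.
by [].
Qed.

Lemma delta_rest (R : realType) (c : R) (Vi Ve : 'rV[R]_4) (n : R * R) :
  isobaric_at c Vi -> isobaric_at c Ve -> delta Vi Ve n = 0.
Proof.
move=> [ui vi _] [ue ve _]; rewrite /delta /vel_dot ui vi ue ve !mul0r addr0.
by rewrite minxx maxxx oppr0 mul0r maxxx.
Qed.

Lemma flux_mod_isobaric (R : realType) (g alpha c : R) (Vi Ve : 'rV[R]_4)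
    (n : R * R) :
  0 < g -> 0 < Vi 0 0 /\ isobaric_at c Vi -> 0 < Ve 0 0 /\ isobaric_at c Ve ->
  flux_mod g alpha Vi Ve n = row4 0 (c * n.1) (c * n.2) 0.
Proof.
move=> g0 [hi Vic] [he Vec]; rewrite /flux_mod (delta_rest _ Vic Vec) mulr0.
rewrite scale0r subr0; apply/rowP => i.
rewrite /flux_dot (flux_isobaric g0 hi Vic) (flux_isobaric g0 he Vec) !mxE /=.
by case: i => -[|[|[|[|//]]]] ? /=;
  rewrite !(mul0r, addr0, add0r, mulr0)//; field.
Qed.

(** * The integrand on a cell boundary *)

Lemma near_cell_ray (R : realType) (T : rect R) (x n : R * R) (e0 : R) :
  0 < e0 -> closed_cell T x -> cell T (ray x n e0) ->
  \forall e \near 0^'+, cell T (ray x n e).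
Proof.
move=> e0_gt0 [/= Tx1 Tx2] [/= Te1 Te2].
have itv (a m lo hi e : R) : 0 < e -> e <= e0 -> a \in `[lo, hi] ->
    a + e0 * m \in `]lo, hi[ -> a + e * m \in `]lo, hi[.
  rewrite !in_itv /= => e_gt0 ee0 /andP[l h] /andP[l0 h0].
  (* Multiplied by [e0], the coordinate is [(e0 - e) * a + e * (a + e0 * m)], with weights
     [e0 - e >= 0] and [e > 0]. *)
  by apply/andP; split; rewrite -(ltr_pM2l e0_gt0); nra.
near=> e; have e_gt0 : 0 < e by near: e; exact: nbhs_right_gt.
have ee0 : e <= e0 by near: e; exact: nbhs_right_ltW.
by split; exact: itv.
Unshelve. all: by end_near. Qed.

(** On the boundary of [Omega] the datum is isobaric. Inside, openness keeps the ray in [Omega],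
    where it runs in a single open cell near its origin, and [trace_isobaric] applies to that
    neighbour. *)
Lemma V_ext_isobaric (R : realType) (c : R) (Omega : set (R * R)) (I : finType)
    (K : I -> rect R) (k : nat) (Vbd V : R * R -> 'rV[R]_4) (x n : R * R) :
  mesh_of Omega K ->
  (forall x, (closure Omega `\` Omega) x ->
     0 < Vbd x 0 0 /\ isobaric_at c (Vbd x)) ->
  pos_on_closed_cells K k (component 0 V) ->
  (forall i x, cell (K i) x -> isobaric_at c (V x)) ->
  closure Omega x ->
  (forall i, (n.1 != 0) || (x.1 \notin [:: xlo (K i); xhi (K i)])) ->
  (forall i, (n.2 != 0) || (x.2 \notin [:: ylo (K i); yhi (K i)])) ->
  let W := V_ext Omega Vbd V x n in 0 < W 0 0 /\ isobaric_at c W.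
Proof.
move=> [oO _ _ OK] Vbdc posV isoV Ox x1 x2; rewrite /V_ext.
case: asboolP => [/Vbdc//|nbd].
have {Ox nbd} Ox : Omega x by apply: contrapT => nOx; apply: nbd.
have [i nKx] : exists i, \forall e \near 0^'+, cell (K i) (ray x n e).
  apply: near_ray_one_cell.
  have nOx : \forall e \near 0^'+, Omega (ray x n e).
    by apply: (@ray_cvg _ x n); exact: open_nbhs_nbhs.
  have nKx : \forall e \near (0 : R)^'+,
      forall i, closed_cell (K i) (ray x n e) -> cell (K i) (ray x n e).
    by apply: filter_forall => i; exact: near_ray_cell.
  near=> e; have [i _ Ki] : (\bigcup_i closed_cell (K i)) (ray x n e).
    by apply: OK; near: e.
  by exists i; apply: (near nKx e).
exact: trace_isobaric posV (isoV i) nKx.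
Unshelve. all: by end_near. Qed.

Lemma boundary_integrand (R : realType) (g alpha c : R) (Omega : set (R * R))
    (I : finType) (K : I -> rect R) (k : nat) (Vbd V phi : R * R -> 'rV[R]_4)
    (i : I) (u1 u2 : {poly {poly R}}) (x n : R * R) :
  0 < g -> mesh_of Omega K ->
  (forall x, (closure Omega `\` Omega) x ->
     0 < Vbd x 0 0 /\ isobaric_at c (Vbd x)) ->
  pos_on_closed_cells K k (component 0 V) ->
  (forall i x, cell (K i) x -> isobaric_at c (V x)) ->
  (forall y, cell (K i) y -> phi y 0 1 = u1.[y.1, y.2]) ->
  (forall y, cell (K i) y -> phi y 0 2 = u2.[y.1, y.2]) ->
  (\forall e \near 0^'+, cell (K i) (ray x (- n.1, - n.2) e)) ->
  (forall i, (n.1 != 0) || (x.1 \notin [:: xlo (K i); xhi (K i)])) ->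
  (forall i, (n.2 != 0) || (x.2 \notin [:: ylo (K i); yhi (K i)])) ->
  dot4 (flux_mod g alpha (V_int V x n) (V_ext Omega Vbd V x n) n)
    (V_int phi x n) = c * (n.1 * u1.[x.1, x.2] + n.2 * u2.[x.1, x.2]).
Proof.
move=> g0 meshK Vbdc posV isoV phi1 phi2 nKx x1 x2.
(* As a limit of points of the cell, [x] is either in [Omega] or on its boundary, the two cases of
   the exterior trace. *)
have Ox : closure Omega x.
  have nOx : \forall e \near 0^'+, closure Omega (ray x (- n.1, - n.2) e).
    case: meshK => _ KO _ _; apply: filterS nKx => e /KO; exact: subset_closure.
  exact: (@closed_cvg _ _ _ _ (ray x (- n.1, - n.2)) (closure Omega)
    (@closed_closure _ Omega) nOx x (@ray_cvg _ x (- n.1, - n.2))).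
rewrite (flux_mod_isobaric alpha n g0 (c := c)); last 2 first.
- by rewrite V_intE; exact: trace_isobaric posV (isoV i) nKx.
- exact: V_ext_isobaric meshK Vbdc posV isoV Ox x1 x2.
have phiE (j : 'I_4) (u : {poly {poly R}}) :
    (forall y, cell (K i) y -> phi y 0 j = u.[y.1, y.2]) ->
    V_int phi x n 0 j = u.[x.1, x.2].
  move=> phiu; rewrite V_intE mxE.
  rewrite (@trace_ext_eq _ _ (fun x => u.[x.1, x.2]))//.
    by apply: filterS nKx => e; exact: phiu.
  exact: continuous_horner2.
by rewrite dot4E (phiE 1 u1 phi1) (phiE 2 u2 phi2) !mxE /= !mul0r; ring.
Qed.

(** * The integrals over a cell *)

Lemma cell_nbhs (R : realType) (T : rect R) (x : R * R) :
  cell T x ->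
  (\forall s \near x.1, cell T (s, x.2)) /\
  (\forall s \near x.2, cell T (x.1, s)).
Proof.
move=> [/= x1 x2]; split; near=> s; split => //=; near: s;
  by apply: open_nbhs_nbhs; split=> //; exact: itv_open.
Unshelve. all: by end_near. Qed.

(** Cells are open, so the two functions agree near [x] along the horizontal line. *)
Lemma dx_eq_cell (R : realType) (T : rect R) (f q : R * R -> R) (x : R * R) :
  (forall y, cell T y -> f y = q y) -> cell T x -> dx f x = dx q x.
Proof.
move=> fq /cell_nbhs[Tx _]; rewrite /dx !derive1E; apply: near_eq_derive.
by apply: filterS Tx => s; exact: fq.
Qed.

Lemma dy_eq_cell (R : realType) (T : rect R) (f q : R * R -> R) (x : R * R) :
  (forall y, cell T y -> f y = q y) -> cell T x -> dy f x = dy q x.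
Proof.
move=> fq /cell_nbhs[_ Tx]; rewrite /dy !derive1E; apply: near_eq_derive.
by apply: filterS Tx => s; exact: fq.
Qed.

Lemma source_const (R : realType) (g b0 : R) (T : rect R) (b : R * R -> R)
    (U : 'rV[R]_4) (x : R * R) :
  (forall y, cell T y -> b y = b0) -> cell T x -> source g b U x = 0.
Proof.
move=> bc Tx; apply/rowP => j; rewrite /source !mxE.
rewrite (dx_eq_cell (q := cst b0) bc Tx) (dy_eq_cell (q := cst b0) bc Tx).
rewrite /dx /dy !derive1_cst !mulr0 oppr0.
by case: j => -[|[|[|[|]]]].
Qed.

(** Only the two pressure entries of the flux survive, so contracting with the gradient gives [c]
    times the divergence of the momentum components of [phi]. *)
Lemma int_cell_flux (R : realType) (g c : R) (T : rect R)
    (V phi : R * R -> 'rV[R]_4) (u1 u2 : {poly {poly R}}) :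
  0 < g ->
  (forall x, cell T x -> 0 < V x 0 0 /\ isobaric_at c (V x)) ->
  (forall x, cell T x -> phi x 0 1 = u1.[x.1, x.2]) ->
  (forall x, cell T x -> phi x 0 2 = u2.[x.1, x.2]) ->
  int_cell T (fun x => frob (flux g (cons_of_equil g (V x))) (grad phi x))
  = c * (int_cell T (dx (fun x => u1.[x.1, x.2]))
         + int_cell T (dy (fun x => u2.[x.1, x.2]))).
Proof.
move=> g0 Vc phi1 phi2; have mT := measurable_cell T.
rewrite -[X in c * X]RintegralD//; [|exact: integrable_dx|exact: integrable_dy].
rewrite -[RHS]RintegralZl//; last first.
  exact: (integrableD mT (integrable_dx T u1) (integrable_dy T u2)).
apply: eq_Rintegral => x; rewrite inE => Tx.
have [h0 iso] := Vc x Tx.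
rewrite frobE !dot4E (flux_isobaric g0 h0 iso) !mxE /=.
rewrite !mul0r !add0r !addr0 /= mulrDr.
by rewrite (dx_eq_cell phi1 Tx) (dy_eq_cell phi2 Tx).
Qed.

(** * Cancellation in the spatial operator, and the scheme *)

Lemma int_boundary_flux (R : realType) (g alpha c : R) (Omega : set (R * R))
    (I : finType) (K : I -> rect R) (k : nat) (Vbd V phi : R * R -> 'rV[R]_4)
    (i : I) (u1 u2 : {poly {poly R}}) :
  0 < g -> mesh_of Omega K ->
  (forall x, (closure Omega `\` Omega) x ->
     0 < Vbd x 0 0 /\ isobaric_at c (Vbd x)) ->
  pos_on_closed_cells K k (component 0 V) ->
  (forall i x, cell (K i) x -> isobaric_at c (V x)) ->
  (forall y, cell (K i) y -> phi y 0 1 = u1.[y.1, y.2]) ->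
  (forall y, cell (K i) y -> phi y 0 2 = u2.[y.1, y.2]) ->
  int_boundary (K i) (fun x n =>
    dot4 (flux_mod g alpha (V_int V x n) (V_ext Omega Vbd V x n) n)
      (V_int phi x n))
  = c * (int_cell (K i) (dx (fun x => u1.[x.1, x.2]))
         + int_cell (K i) (dy (fun x => u2.[x.1, x.2]))).
Proof.
move=> g0 meshK Vbdc posV isoV phi1 phi2.
have integrandE := boundary_integrand alpha g0 meshK Vbdc posV isoV phi1 phi2.
(* These finite lists hold the coordinates of all lines carrying mesh edges, hence of every possible
   hanging node on a side. *)
pose sx := flatten [seq [:: xlo (K j); xhi (K j)] | j <- enum I].
pose sy := flatten [seq [:: ylo (K j); yhi (K j)] | j <- enum I].
have sxP a : a \notin sx -> forall j, a \notin [:: xlo (K j); xhi (K j)].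
  move=> /flattenP nsx j; apply/negP => aj; apply: nsx.
  exists [:: xlo (K j); xhi (K j)] => //.
  by apply/mapP; exists j; rewrite ?mem_enum.
have syP a : a \notin sy -> forall j, a \notin [:: ylo (K j); yhi (K j)].
  move=> /flattenP nsy j; apply/negP => aj; apply: nsy.
  exists [:: ylo (K j); yhi (K j)] => //.
  by apply/mapP; exists j; rewrite ?mem_enum.
have xlh := xlo_lt_xhi (K i); have ylh := ylo_lt_yhi (K i).
(* Both vertical sides at once, with [m] the sign of the outward normal; the parameter [e] certifies
   that the opposite direction enters the cell. *)
have side_x (x m : R) : x \in `[xlo (K i), xhi (K i)] -> m != 0 ->
    (exists2 e, 0 < e & x - e * m \in `]xlo (K i), xhi (K i)[) ->
    (\int[@lebesgue_measure R]_(y in `]ylo (K i), yhi (K i)[)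
       dot4 (flux_mod g alpha (V_int V (x, y) (m, 0))
               (V_ext Omega Vbd V (x, y) (m, 0)) (m, 0))
         (V_int phi (x, y) (m, 0))
     = c * m * \int[@lebesgue_measure R]_(y in `]ylo (K i), yhi (K i)[)
                 u1.[x, y])%R.
  move=> xi m0 [e e0 xe]; rewrite -RintegralZl//; last exact: integrable_horner.
  apply: (eq_Rintegral_setD_seq (s := sy)) => //.
    by apply: measurable_funM => //; exact: measurable_horner.
  move=> y yi ysy; rewrite integrandE /=.
  - by rewrite mul0r addr0 mulrA.
  - apply: (near_cell_ray e0); split => //=; first exact: subset_itv_oo_cc.
    + by rewrite mulrN.
    + by rewrite oppr0 mulr0 addr0.
  - by move=> j; rewrite m0.
  - by move=> j; rewrite syP// orbT.
have side_y (y m : R) : y \in `[ylo (K i), yhi (K i)] -> m != 0 ->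
    (exists2 e, 0 < e & y - e * m \in `]ylo (K i), yhi (K i)[) ->
    (\int[@lebesgue_measure R]_(x in `]xlo (K i), xhi (K i)[)
       dot4 (flux_mod g alpha (V_int V (x, y) (0, m))
               (V_ext Omega Vbd V (x, y) (0, m)) (0, m))
         (V_int phi (x, y) (0, m))
     = c * m * \int[@lebesgue_measure R]_(x in `]xlo (K i), xhi (K i)[)
                 u2.[x, y])%R.
  move=> yi m0 [e e0 ye].
  rewrite -RintegralZl//; last exact: integrable_horner2_l.
  apply: (eq_Rintegral_setD_seq (s := sx)) => //.
    apply: measurable_funM => //; apply/measurable_EFinP.
    exact: measurable_int (integrable_horner2_l u2 y _ _).
  move=> x xi xsx; rewrite integrandE /=.
  - by rewrite mul0r add0r mulrA.
  - apply: (near_cell_ray e0); split => //=; first exact: subset_itv_oo_cc.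
    + by rewrite oppr0 mulr0 addr0.
    + by rewrite mulrN.
  - by move=> j; rewrite sxP// orbT.
  - by move=> j; rewrite m0.
rewrite /int_boundary !side_x ?side_y ?oppr_eq0 ?oner_eq0
  ?in_itv/= ?lexx ?ltW//.
- by rewrite int_cell_dx int_cell_dy; ring.
(* Half the cell size: the inward ray then ends at the midpoint. *)
- by exists ((yhi (K i) - ylo (K i)) / 2); rewrite ?in_itv/=; lra.
- by exists ((yhi (K i) - ylo (K i)) / 2); rewrite ?in_itv/=; lra.
- by exists ((xhi (K i) - xlo (K i)) / 2); rewrite ?in_itv/=; lra.
- by exists ((xhi (K i) - xlo (K i)) / 2); rewrite ?in_itv/=; lra.
Qed.

Lemma RHS_iso_isobaric (R : realType) (g c b0 : R) (Omega : set (R * R))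
    (I : finType) (K : I -> rect R) (k : nat) (b : R * R -> R)
    (Vbd V phi : R * R -> 'rV[R]_4) (i : I) :
  0 < g -> mesh_of Omega K ->
  (forall x, Omega x -> b x = b0) ->
  (forall x, (closure Omega `\` Omega) x ->
     0 < Vbd x 0 0 /\ isobaric_at c (Vbd x)) ->
  pos_on_closed_cells K k (component 0 V) ->
  (forall i x, cell (K i) x -> isobaric_at c (V x)) ->
  in_Vh K k phi ->
  RHS_iso g Omega K Vbd (K i) V b phi = 0.
Proof.
move=> g0 meshK bc Vbdc posV isoV Vphi; rewrite /RHS_iso.
have [q1 /poly2_horner2[u1 u1E] phi1] := Vphi 1 i.
have [q2 /poly2_horner2[u2 u2E] phi2] := Vphi 2 i.
have {u1E} phi1 x : cell (K i) x -> phi x 0 1 = u1.[x.1, x.2].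
  by rewrite -u1E; exact: phi1.
have {u2E} phi2 x : cell (K i) x -> phi x 0 2 = u2.[x.1, x.2].
  by rewrite -u2E; exact: phi2.
have Vc x : cell (K i) x -> 0 < V x 0 0 /\ isobaric_at c (V x).
  move=> Kx; split; last exact: isoV Kx.
  have [q [_ Vq q0]] := posV i.
  by have := q0 x (cell_sub_closed_cell Kx); rewrite -Vq.
rewrite (int_cell_flux g0 Vc phi1 phi2).
rewrite (int_boundary_flux _ g0 meshK Vbdc posV isoV phi1 phi2) subrr add0r.
(* The cell lies in [Omega], so the bottom is constant on it and the source vanishes there. *)
rewrite /int_cell; under eq_Rintegral => x /set_mem Kx.
  rewrite (source_const (b0 := b0) _ _ _ Kx); last first.
    by move=> y Ky; apply: bc; case: meshK => _ KO _ _; exact: KO Ky.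
  rewrite dot4E !mxE !mul0r !addr0; over.
by rewrite /Rintegral integral0_eq.
Qed.

Theorem theorem3p4 (R : realType) (g dt c b0 : R) (k : nat)
    (Omega : set (R * R)) (I : finType) (K : I -> rect R)
    (b : R * R -> R) (Vbd V0 : R * R -> 'rV[R]_4) :
  0 < g -> 0 < dt ->
  mesh_of Omega K ->
  (forall x, Omega x -> b x = b0) ->
  (forall x, (closure Omega `\` Omega) x ->
     0 < Vbd x 0 0 /\ isobaric_at c (Vbd x)) ->
  in_Vh K k V0 ->
  pos_on_closed_cells K k (component 0 V0) ->
  (forall i x, cell (K i) x -> isobaric_at c (V0 x)) ->
  scheme_solution g dt Omega K k Vbd b
    (fun=> V0) (fun=> V0) (fun=> V0).
Proof.
move=> g0 _ meshK bc Vbdc VV posV isoV n; split=> // i phi Vphi /=.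
rewrite (RHS_iso_isobaric i g0 meshK bc Vbdc posV isoV Vphi).
(* With zero right-hand sides each stage is a convex combination of equal masses:
   [3 / 4 + 1 / 4 = 1] and [1 / 3 + 2 / 3 = 1]. *)
by split; field.
Qed.
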